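(* Let $(V,\leq)$ be a finite partially ordered set. Then the group (under composition) of DAG automorphisms of $\mathbb{N}^V$ is equal to $W(V)$. That is, a map $\tau:\mathbb{N}^V\to\mathbb{N}^V$ is a DAG automorphism if and only if there is a family of permutations $\sigma=(\sigma_{v,a})_{v\in V,\ a\in\mathbb{N}^{\mathcal{A}(v)}}$ with each $\sigma_{v,a}\in\operatorname{Sym}(\mathbb{N})$ such that \[ (\tau\alpha)(v)=\sigma_{v,\alpha|_{\mathcal{A}(v)}}\bigl(\alpha(v)\bigr)\qquad\text{for all } \alpha\in\mathbb{N}^V,\ v\in V. \]
   Context: Let $(V,\leq)$ be a finite partially ordered set. $\mathbb{N}^V$ is the set of functions $\alpha:V\to\mathbb{N}$, and for $D\subseteq V$, $\alpha|_D=(\alpha(u))_{u\in D}\in\mathbb{N}^D$ denotes the restriction. $\operatorname{Sym}(\mathbb{N})$ is the group of all bijections $\mathbb{N}\to\mathbb{N}$. For $v\in V$, the set of strict ancestors of $v$ is $\mathcal{A}(v)=\{u\in V: u<v\}$; if $\mathcal{A}(v)=\varnothing$ then $\mathbb{N}^{\mathcal{A}(v)}$ consists of the empty tuple only. Definition of $W(V)$ (generalized wreath product of symmetric groups): for a family $\sigma=(\sigma_{v,a})$, with one permutation $\sigma_{v,a}\in\operatorname{Sym}(\mathbb{N})$ for each $v\in V$ and each $a\in\mathbb{N}^{\mathcal{A}(v)}$, define $\tau_\sigma:\mathbb{N}^V\to\mathbb{N}^V$ by $(\tau_\sigma\alpha)(v)=\sigma_{v,\alpha|_{\mathcal{A}(v)}}(\alpha(v))$.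 $W(V)$ is the set of all maps $\tau_\sigma$ of this form. Downsets: $\mathcal{D}(V)$ is the set of downward-closed subsets $D\subseteq V$ (i.e. $v\in D$ and $u\leq v$ imply $u\in D$). DAG automorphism: a bijection $\tau:\mathbb{N}^V\to\mathbb{N}^V$ such that for every $D\in\mathcal{D}(V)$ and all $\alpha,\beta\in\mathbb{N}^V$, \[ \alpha|_D=\beta|_D\iff(\tau\alpha)|_D=(\tau\beta)|_D. \] *)

(* Defs.v *)
From HB Require Import structures.
From mathcomp Require Import all_boot all_order.
Set Implicit Arguments.
Unset Strict Implicit.
Unset Printing Implicit Defensive.
Local Open Scope order_scope.

Section Defs.
Variables (d : Order.disp_t) (V : finPOrderType d).

Definition tuples (D : {set V}) : Type := {ffun {u : V | u \in D} -> nat}.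

Definition restr (D : {set V}) (alpha : {ffun V -> nat}) : tuples D :=
  [ffun u => alpha (val u)].

Definition ancestors (v : V) : {set V} := [set u | u < v].

Definition downset (D : {set V}) : Prop :=
  forall u v : V, v \in D -> u <= v -> u \in D.

Definition SymN : Type := {s : nat -> nat | bijective s}.

Definition perm_family : Type := forall v : V, tuples (ancestors v) -> SymN.

Definition tau_of (sigma : perm_family) (alpha : {ffun V -> nat}) :
    {ffun V -> nat} :=
  [ffun v => sval (sigma v (restr (ancestors v) alpha)) (alpha v)].

(* Maps are compared pointwise, since Leibniz equality of Rocq functions is    *)
(* not extensional without an axiom.                                          *)
Definition wreath (tau : {ffun V -> nat} -> {ffun V -> nat}) : Prop :=
  exists sigma : perm_family, tau =1 tau_of sigma.

Definition dag_automorphism (tau : {ffun V -> nat} -> {ffun V -> nat}) : Prop :=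
  bijective tau /\
  forall D : {set V}, downset D -> forall alpha beta : {ffun V -> nat},
    restr D alpha = restr D beta <-> restr D (tau alpha) = restr D (tau beta).

End Defs.

Definition composition_group (X : Type) (G : (X -> X) -> Prop) : Prop :=
  [/\ G id,
      forall f g : X -> X, G f -> G g -> G (f \o g) &
      forall f : X -> X, G f ->
        exists g : X -> X, [/\ G g, cancel f g & cancel g f]].

(* Main.v *)
Require Import Defs.
From HB Require Import structures.
From mathcomp Require Import all_boot all_order.

(** A DAG automorphism [tau] respects agreement on the downsets [{u | u < v}]
    and [{u | u <= v}], so [tau alpha v] is a function of [alpha v] and of
    [alpha] below [v]; for a fixed tuple below [v] its inverse is read off from
    the inverse of [tau] in the same way.  Conversely, a map [tau_sigma] can be
    inverted coordinate by coordinate, going up the order. *)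

Set Implicit Arguments.
Unset Strict Implicit.
Unset Printing Implicit Defensive.
Import Order.TTheory.
Local Open Scope order_scope.

Section DagAutomorphisms.
Variables (d : Order.disp_t) (V : finPOrderType d).
Implicit Types (D : {set V}) (u v : V) (alpha beta : {ffun V -> nat}).
Implicit Types (tau : {ffun V -> nat} -> {ffun V -> nat}).

Lemma restrP D alpha beta :
  restr D alpha = restr D beta <-> {in D, alpha =1 beta}.
Proof.
split=> [/ffunP eqD u uD | eqD].
  by have := eqD (exist _ u uD); rewrite !ffunE.
by apply/ffunP=> -[u uD]; rewrite !ffunE eqD.
Qed.

Lemma dag_automorphism_id : dag_automorphism (@id {ffun V -> nat}).
Proof. by split=> //; exists id. Qed.

Lemma dag_automorphism_comp tau1 tau2 :
  dag_automorphism tau1 -> dag_automorphism tau2 ->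
  dag_automorphism (tau1 \o tau2).
Proof.
case=> bij1 dag1 [bij2 dag2]; split=> [|D dD alpha beta]; first exact: bij_comp.
exact: iff_trans (dag2 D dD _ _) (dag1 D dD _ _).
Qed.

Lemma dag_automorphism_inv tau : dag_automorphism tau ->
  exists tau', [/\ dag_automorphism tau', cancel tau tau' & cancel tau' tau].
Proof.
case=> -[tau' tauK tau'K] dag; exists tau'; split=> //; split; first by exists tau.
move=> D dD alpha beta; apply: iff_sym.
by have := dag D dD (tau' alpha) (tau' beta); rewrite !tau'K.
Qed.

Definition principal_downset v : {set V} := [set u | u <= v].

Lemma downset_ancestors v : downset (ancestors v).
Proof. by move=> u w; rewrite !inE => wv uw; apply: le_lt_trans wv. Qed.

Lemma downset_principal v : downset (principal_downset v).
Proof. by move=> u w; rewrite !inE => wv uw; apply: le_trans wv. Qed.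

Lemma sub_ancestors D v : downset D -> v \in D -> {subset ancestors v <= D}.
Proof. by move=> dD vD u; rewrite inE => /ltW; apply: dD. Qed.

Lemma card_ancestors_lt u v : u < v -> (#|ancestors u| < #|ancestors v|)%N.
Proof.
move=> uv; apply/proper_card/properP; split; last by exists u; rewrite !inE ?ltxx.
by apply/subsetP=> w; rewrite !inE => /lt_trans; apply.
Qed.

(** Coordinates outside the principal downset of [v] get the junk value 0; a DAG automorphism
    ignores them when computing coordinate [v]. *)
Definition extend v (a : tuples (ancestors v)) (n : nat) : {ffun V -> nat} :=
  [ffun u => if u == v then n else oapp a 0%N (insub u)].

Lemma extend_top v (a : tuples (ancestors v)) n : extend a n v = n.
Proof. by rewrite ffunE eqxx. Qed.

Lemma restr_extend v (a : tuples (ancestors v)) n :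
  restr (ancestors v) (extend a n) = a.
Proof.
apply/ffunP=> -[u uv]; rewrite !ffunE /=.
case: eqVneq => [e|_]; last by rewrite insubT.
by have := uv; rewrite {1}e {1}inE ltxx.
Qed.

Lemma restr_principalP v alpha beta :
  restr (principal_downset v) alpha = restr (principal_downset v) beta <->
  restr (ancestors v) alpha = restr (ancestors v) beta /\ alpha v = beta v.
Proof.
split=> [/restrP eqP | [/restrP eqA eqv]].
  by split; [apply/restrP=> u; rewrite inE => /ltW uv|]; apply: eqP; rewrite inE.
apply/restrP=> u; rewrite inE le_eqVlt => /orP[/eqP-> //|uv].
by apply: eqA; rewrite inE.
Qed.

Lemma dag_automorphism_coord_bij tau v (a : tuples (ancestors v)) :
  dag_automorphism tau -> bijective (fun n => tau (extend a n) v).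
Proof.
case=> -[tau' tauK tau'K] dag.
have dagA := dag _ (@downset_ancestors v).
have dagP := dag _ (@downset_principal v).
(* The 0 is an arbitrary choice: by [tau_b] the image tuple below [v] is the same for every [n], so
   it can be frozen as [b] in the inverse. *)
pose b := restr (ancestors v) (tau (extend a 0)).
have tau_b n : restr (ancestors v) (tau (extend a n)) = b.
  by apply: (dagA _ _).1; rewrite !restr_extend.
exists (fun m => tau' (extend b m) v) => [n | m].
- suff /restr_principalP[_ ->] : restr (principal_downset v)
      (tau' (extend b (tau (extend a n) v))) =
      restr (principal_downset v) (extend a n) by rewrite extend_top.
  apply/dagP; rewrite tau'K; apply/restr_principalP.
  by rewrite restr_extend extend_top tau_b.
- set n := tau' _ _.
  suff /dagP/restr_principalP[_ ->] : restr (principal_downset v) (extend a n) =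
      restr (principal_downset v) (tau' (extend b m)) by rewrite tau'K extend_top.
  apply/restr_principalP; rewrite extend_top restr_extend; split=> //.
  (* Writing [a] as a restriction lets [dagA] compare images instead, and both images restrict to
     [b]. *)
  rewrite -{1}(restr_extend a 0); apply/dagA.
  by rewrite tau'K restr_extend.
Qed.

Lemma dag_automorphism_wreath tau : dag_automorphism tau -> wreath tau.
Proof.
move=> dag_tau.
exists (fun v a => exist _ _ (dag_automorphism_coord_bij a dag_tau)) => alpha.
apply/ffunP=> v; rewrite ffunE /=.
have [_ dag] := dag_tau.
suff /(dag _ (@downset_principal v))/restr_principalP[_ <-] :
    restr (principal_downset v) (extend (restr (ancestors v) alpha) (alpha v)) =
    restr (principal_downset v) alpha by [].
by apply/restr_principalP; rewrite restr_extend extend_top.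
Qed.

Lemma SymN_surj (s : SymN) (m : nat) : exists n, sval s n == m.
Proof. by case: s => s [s' sK s'K] /=; exists (s' m); rewrite s'K. Qed.

Lemma SymN_inj (s : SymN) : injective (sval s).
Proof. by case: s => s /= /bij_inj. Qed.

(** Bijectivity lives in [Prop], so no inverse function can be projected from it; one is found by
    searching [nat] with a decidable equation. *)
Definition SymN_inv (s : SymN) (m : nat) : nat := xchoose (SymN_surj s m).

Lemma SymN_invK (s : SymN) : cancel (SymN_inv s) (sval s).
Proof. by move=> m; apply/eqP/(xchooseP (SymN_surj s m)). Qed.

(** Induction on the number of strict ancestors, which increases strictly along [<]. *)
Lemma ancestors_ind (P : V -> Prop) :
  (forall v, (forall u, u < v -> P u) -> P v) -> forall v, P v.
Proof.
move=> IH v; have [n] := ubnP #|ancestors v|; elim: n v => // n IHn v lt_n.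
apply: IH => u uv; apply: IHn; rewrite ltnS in lt_n; apply: leq_trans lt_n.
exact: card_ancestors_lt.
Qed.

Variable sigma : perm_family V.

(** A downset contains the ancestors of its members, so it determines the permutations used there.
    Conversely, going up the order, agreement below [v] makes both sides use one permutation, which
    is injective. *)
Lemma tau_of_restr D alpha beta : downset D ->
  restr D alpha = restr D beta <->
  restr D (tau_of sigma alpha) = restr D (tau_of sigma beta).
Proof.
move=> dD; split=> /restrP eqD; apply/restrP => v.
  move=> vD; rewrite !ffunE eqD //; congr (sval (sigma _) _).
  by apply/restrP => u /(sub_ancestors dD vD); apply: eqD.
elim/ancestors_ind: v => v IH vD; have := eqD v vD; rewrite !ffunE.
have -> : restr (ancestors v) alpha = restr (ancestors v) beta.
  apply/restrP => u uv; apply: IH; last exact: sub_ancestors uv.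
  by rewrite inE in uv.
exact: SymN_inj.
Qed.

(** The guess [alpha] only selects the permutations to invert; the fixed points are exactly the
    preimages of [beta] under [tau_of sigma]. *)
Definition solve_coord beta alpha : {ffun V -> nat} :=
  [ffun v => SymN_inv (sigma (restr (ancestors v) alpha)) (beta v)].

(* After [k] iterations, coordinates with fewer than [k] ancestors are final. *)
Lemma iter_solve_coord beta k v : (#|ancestors v| < k)%N ->
  iter k.+1 (solve_coord beta) beta v = iter k (solve_coord beta) beta v.
Proof.
elim: k v => // k IH v lt_k; rewrite iterS [in RHS]iterS !ffunE.
congr (SymN_inv (sigma _) _); apply/restrP => u; rewrite inE => uv.
by apply: IH; apply: leq_trans (card_ancestors_lt uv) _.
Qed.

(** No element has more than [#|V|] ancestors, so this many rounds settle every coordinate. *)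
Definition tau_of_inv beta := iter #|V|.+1 (solve_coord beta) beta.

Lemma tau_of_invK : cancel tau_of_inv (tau_of sigma).
Proof.
move=> beta; apply/ffunP=> v; rewrite ffunE.
(* One extra round is added to the argument only: it inverts the very permutation selected by the
   unchanged iterate outside. *)
rewrite /tau_of_inv -[X in sval _ X]iter_solve_coord ?ltnS ?max_card //.
by rewrite iterS ffunE SymN_invK.
Qed.

Lemma tau_of_inj : injective (tau_of sigma).
Proof.
move=> alpha beta eq_tau.
have /restrP eqT : restr setT alpha = restr setT beta.
  by apply/tau_of_restr; [move=> u v | rewrite eq_tau].
by apply/ffunP=> v; apply: eqT.
Qed.

Lemma tau_of_bij : bijective (tau_of sigma).
Proof.
exists tau_of_inv; last exact: tau_of_invK.
(* A right inverse of an injective map is also a left inverse. *)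
by apply: inj_can_sym tau_of_inj; apply: tau_of_invK.
Qed.

Lemma tau_of_dag_automorphism tau : tau =1 tau_of sigma -> dag_automorphism tau.
Proof.
move=> eq_tau; split; first exact: eq_bij tau_of_bij _ (fsym eq_tau).
by move=> D dD alpha beta; rewrite !eq_tau; apply: tau_of_restr.
Qed.

End DagAutomorphisms.

Theorem proposition2p1 (d : Order.disp_t) (V : finPOrderType d) :
  composition_group (@dag_automorphism d V) /\
  (forall tau : {ffun V -> nat} -> {ffun V -> nat},
     dag_automorphism tau <-> wreath tau).
Proof.
split.
  split; [exact: dag_automorphism_id | exact: dag_automorphism_comp |].
  exact: dag_automorphism_inv.
move=> tau; split; first exact: dag_automorphism_wreath.
by case=> sigma; apply: tau_of_dag_automorphism.
Qed.
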